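(* Let $\{G_i\}_{i \in I}$ be a family of compact topological groups. Then the topos $\bigsqcup_{i \in I} \mathbf{Cont}(G_i)$ is EILC.
   Context: For a topological group $G$, the classifying topos $\mathbf{Cont}(G)$ is the topos of sets equipped with a continuous action of $G$, where sets are viewed as topological spaces with the discrete topology. The disjoint union $\bigsqcup_{i\in I} \mathbf{Cont}(G_i)$ is computed in the category of Grothendieck toposes; explicitly, its objects are families $(A_i)_{i\in I}$ with each $A_i$ an object of $\mathbf{Cont}(G_i)$ (and its morphisms are families of morphisms), i.e. it is the product of the underlying categories. A geometric morphism $f : \mathcal{F} \to \mathcal{E}$ between elementary toposes is essential if the inverse image functor $f^*$ has a left adjoint, written $f_!$. It is locally connected if it is essential and for all morphisms $A \to B$ in $\mathcal{E}$ and $X \to f^*B$ in $\mathcal{F}$ the natural morphism $f_!(X \times_{f^*B} f^*A) \to f_!(X) \times_B A$ is an isomorphism (here $f_!(X)\to B$ is the adjoint transpose of $X \to f^*B$). An elementary topos $\mathcal{E}$ is EILC if every essential geometric morphism $f : \mathcal{F} \to \mathcal{E}$ (with $\mathcal{F}$ an elementary topos) is locally connected. *)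

(* Defs.v *)
From HB Require Import structures.
From mathcomp Require Import all_boot.
From mathcomp Require Import boolp classical_sets filter topology.

Set Implicit Arguments.
Unset Strict Implicit.
Unset Printing Implicit Defensive.

Local Open Scope classical_set_scope.

Declare Scope cat_scope.
Delimit Scope cat_scope with cat.
Local Open Scope cat_scope.

(** Morphisms are compared with Leibniz equality.  All notions given by a
    universal property are predicates on a candidate, so nothing depends on a
    choice of limits. *)

Record Category := {
  ob :> Type;
  hom : ob -> ob -> Type;
  idm : forall A, hom A A;
  comp : forall A B C, hom B C -> hom A B -> hom A C;
  compA : forall A B C D (h : hom C D) (g : hom B C) (f : hom A B),
    comp h (comp g f) = comp (comp h g) f;
  comp1m : forall A B (f : hom A B), comp (idm B) f = f;
  compm1 : forall A B (f : hom A B), comp f (idm A) = f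
}.
Arguments hom {c} A B.
Arguments idm {c} A.
Arguments comp {c A B C} g f.

Notation "g ∘ f" := (comp g f) (at level 40, left associativity) : cat_scope.

Section Limits.
Context {C : Category}.

Definition is_iso (A B : C) (f : hom A B) : Prop :=
  exists g : hom B A, g ∘ f = idm A /\ f ∘ g = idm B.

Definition is_mono (A B : C) (f : hom A B) : Prop :=
  forall (T : C) (a b : hom T A), f ∘ a = f ∘ b -> a = b.

Definition is_terminal (T : C) : Prop :=
  forall A : C, exists! u : hom A T, True.

Definition is_product (A B P : C) (p : hom P A) (q : hom P B) : Prop :=
  forall (T : C) (a : hom T A) (b : hom T B),
    exists! u : hom T P, p ∘ u = a /\ q ∘ u = b.

(** [p, q] is a pullback of the cospan [f, g]. *)
Definition is_pullback (A B D P : C) (f : hom A D) (g : hom B D)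
    (p : hom P A) (q : hom P B) : Prop :=
  f ∘ p = g ∘ q /\
  forall (T : C) (a : hom T A) (b : hom T B), f ∘ a = g ∘ b ->
    exists! u : hom T P, p ∘ u = a /\ q ∘ u = b.

(** [E], with evaluation [ev] defined on the product [P] of [E] and [A], is
    the exponential B^A; below, [u] is the morphism [k] × [A]. *)
Definition is_exponential (A B E P : C)
    (p : hom P E) (q : hom P A) (ev : hom P B) : Prop :=
  is_product p q /\
  forall (T Q : C) (r : hom Q T) (s : hom Q A), is_product r s ->
    forall h : hom Q B,
    exists! k : hom T E, exists u : hom Q P,
      [/\ p ∘ u = k ∘ r, q ∘ u = s & ev ∘ u = h].

Definition is_subobject_classifier (one Omega : C) (tr : hom one Omega)
    : Prop :=
  is_terminal one /\
  forall (U X : C) (m : hom U X), is_mono m ->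
    exists! chi : hom X Omega,
      exists t : hom U one, is_pullback chi tr m t.

End Limits.

(** A terminal object and pullbacks generate all finite limits. *)
Definition has_finite_limits (C : Category) : Prop :=
  (exists T : C, is_terminal T) /\
  (forall (A B D : C) (f : hom A D) (g : hom B D),
    exists (P : C) (p : hom P A) (q : hom P B), is_pullback f g p q).

Definition cartesian_closed (C : Category) : Prop :=
  forall A B : C, exists (E P : C) (p : hom P E) (q : hom P A) (ev : hom P B),
    is_exponential p q ev.

Definition has_subobject_classifier (C : Category) : Prop :=
  exists (one Omega : C) (tr : hom one Omega), is_subobject_classifier tr.

Definition is_elementary_topos (C : Category) : Prop :=
  [/\ has_finite_limits C, cartesian_closed C & has_subobject_classifier C].

Record Functor (C D : Category) := {
  fob :> C -> D;
  fmap : forall A B : C, hom A B -> hom (fob A) (fob B);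
  fmap_id : forall A, fmap (idm A) = idm (fob A);
  fmap_comp : forall (A B E : C) (g : hom B E) (f : hom A B),
    fmap (g ∘ f) = fmap g ∘ fmap f
}.
Arguments fmap {C D} F {A B} f : rename.

(** [L] is left adjoint to [R]. *)
Record Adjunction (C D : Category) (L : Functor C D) (R : Functor D C) := {
  adj_unit : forall X : C, hom X (R (L X));
  adj_counit : forall A : D, hom (L (R A)) A;
  adj_unit_natural : forall (X Y : C) (f : hom X Y),
    fmap R (fmap L f) ∘ adj_unit X = adj_unit Y ∘ f;
  adj_counit_natural : forall (A B : D) (f : hom A B),
    f ∘ adj_counit A = adj_counit B ∘ fmap L (fmap R f);
  triangle_left : forall X : C,
    adj_counit (L X) ∘ fmap L (adj_unit X) = idm (L X);
  triangle_right : forall A : D,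
    fmap R (adj_counit A) ∘ adj_unit (R A) = idm (R A)
}.

Definition transpose (C D : Category) (L : Functor C D) (R : Functor D C)
    (adj : Adjunction L R) (X : C) (A : D) (x : hom X (R A)) : hom (L X) A :=
  adj_counit adj A ∘ fmap L x.

Definition preserves_finite_limits (C D : Category) (F : Functor C D) : Prop :=
  (forall T : C, is_terminal T -> is_terminal (F T)) /\
  (forall (A B E P : C) (f : hom A E) (g : hom B E)
      (p : hom P A) (q : hom P B),
    is_pullback f g p q ->
    is_pullback (fmap F f) (fmap F g) (fmap F p) (fmap F q)).

Record GeometricMorphism (F E : Category) := {
  inverse_image : Functor E F;
  direct_image : Functor F E;
  geom_adj : Adjunction inverse_image direct_image;
  inverse_image_lex : preserves_finite_limits inverse_image
}.

Definition essential (F E : Category) (f : GeometricMorphism F E) : Prop :=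
  exists f_bang : Functor F E, inhabited (Adjunction f_bang (inverse_image f)).

(** [P] is X ×_(f^*B) f^*A, [Q] is f_!(X) ×_B A, and the two equations on [k]
    characterize the natural morphism f_!(P) -> Q.  The condition does not
    depend on the choice of [P], [Q] or of the left adjoint [f_bang], so these
    are quantified universally. *)
Definition locally_connected (F E : Category) (f : GeometricMorphism F E)
    : Prop :=
  essential f /\
  forall (f_bang : Functor F E) (adj : Adjunction f_bang (inverse_image f))
    (A B : E) (X : F) (a : hom A B) (x : hom X (inverse_image f B))
    (P : F) (p1 : hom P X) (p2 : hom P (inverse_image f A))
    (Q : E) (q1 : hom Q (f_bang X)) (q2 : hom Q A),
  is_pullback x (fmap (inverse_image f) a) p1 p2 ->
  is_pullback (transpose adj x) a q1 q2 ->
  forall k : hom (f_bang P) Q,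
    q1 ∘ k = fmap f_bang p1 -> q2 ∘ k = transpose adj p2 -> is_iso k.

Definition EILC (E : Category) : Prop :=
  is_elementary_topos E /\
  forall F : Category, is_elementary_topos F ->
  forall f : GeometricMorphism F E, essential f -> locally_connected f.

HB.mixin Record isTopologicalGroup G of Group G & Topological G := {
  mulg_continuous : continuous (fun z : G * G => (z.1 * z.2)%g);
  invg_continuous : continuous (fun x : G => (x^-1)%g)
}.

#[short(type="topologicalGroupType")]
HB.structure Definition TopologicalGroup :=
  {G of isTopologicalGroup G & Group G & Topological G}.

(** [{classic X}] is [X] itself, with the [choiceType] structure that the
    topology library requires of the points of a space. *)
Definition discrete (X : Type) : topologicalType :=
  discrete_topology {classic X}.

Section ContinuousActions.
Variable G : topologicalGroupType.

Record ContSet := {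
  carrier :> Type;
  act : G -> carrier -> carrier;
  act1 : forall x, act 1%g x = x;
  actM : forall (g h : G) x, act (g * h)%g x = act g (act h x);
  act_continuous :
    continuous (fun z : G * discrete carrier => act z.1 z.2 : discrete carrier)
}.

Record EquivariantMap (X Y : ContSet) := {
  map_fun :> X -> Y;
  map_equivariant : forall g x, map_fun (act g x) = act g (map_fun x)
}.

Lemma equivariant_map_ext (X Y : ContSet) (f g : EquivariantMap X Y) :
  (forall x, f x = g x) -> f = g.
Proof.
case: f g => [f fE] [g gE] /= fg; have {}fg : f = g by apply/funext.
by case: _ / fg gE => gE; rewrite (Prop_irrelevance fE gE).
Qed.

Definition equivariant_id (X : ContSet) : EquivariantMap X X :=
  {| map_fun := id; map_equivariant := fun _ _ => erefl |}.

Lemma equivariant_comp_subproof (X Y Z : ContSet)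
    (g : EquivariantMap Y Z) (f : EquivariantMap X Y) a x :
  g (f (act a x)) = act a (g (f x)).
Proof. by rewrite !map_equivariant. Qed.

Definition equivariant_comp (X Y Z : ContSet)
    (g : EquivariantMap Y Z) (f : EquivariantMap X Y) : EquivariantMap X Z :=
  {| map_fun := fun x => g (f x);
     map_equivariant := equivariant_comp_subproof g f |}.

Definition Cont : Category.
Proof.
refine {| ob := ContSet; hom := EquivariantMap; idm := equivariant_id;
          comp := equivariant_comp |}.
- by move=> *; apply: equivariant_map_ext.
- by move=> *; apply: equivariant_map_ext.
- by move=> *; apply: equivariant_map_ext.
Defined.

End ContinuousActions.

(** The disjoint union of a family of toposes: its underlying category is the
    product of the underlying categories. *)
Definition disjoint_union (I : Type) (E : I -> Category) : Category.
Proof.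
refine {| ob := forall i, E i;
          hom := fun A B => forall i, hom (A i) (B i);
          idm := fun A i => idm (A i);
          comp := fun A B C g f i => g i ∘ f i |}.
- by move=> *; apply: functional_extensionality_dep => i; apply: compA.
- by move=> *; apply: functional_extensionality_dep => i; apply: comp1m.
- by move=> *; apply: functional_extensionality_dep => i; apply: compm1.
Defined.

(* Main.v *)
Require Import Defs.
From mathcomp Require Import all_boot.
From mathcomp Require Import boolp classical_sets filter topology.
Import Defs.

(** Let E be the disjoint union of the Cont(G_i), and let f : F -> E be an
    essential geometric morphism with inverse image fs.  A universal arrow
    X -> fs L ([is_universal]) exhibits L as f_!(X).  A morphism a : A -> B of E
    satisfies base change ([base_change]) if, whenever X -> fs L is universal
    and L lies over B, the comparison map X ×_(fs B) fs A -> fs (L ×_B A) is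
    universal too; f is locally connected as soon as every a satisfies base
    change ([locally_connected_of_base_change]).

    In an elementary topos colimits are stable under pullback
    ([colimit_pullback]), and both fs and f_! preserve colimits.  So base change
    is local on the source and on the target: it holds for a if A is the
    colimit of objects A_n such that each A_n -> A -> B satisfies it
    ([base_change_source]), or if B is the colimit of objects B_n such that each
    A ×_B B_n -> B_n satisfies it ([base_change_target]).  It holds trivially
    for identities.

    Now A is the colimit of the uniform objects over it ([uniform_density]),
    those on which a neighbourhood of the unit acts trivially in each
    component: the orbit of any point is uniform, because the groups are compact.
    So A may be assumed uniform.  Then B is the colimit of the morphisms Y -> B
    along which a splits ([split_density]), that is, such that A ×_B Y is a
    disjoint union of copies of Y: take for Y the object of bijections between
    a set J and a fibre of a, whose stabilizers are open as A is uniform.  When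
    A is a disjoint union of copies of B, base change follows by locality on
    the source from the case of identities.  That E is an elementary topos is
    checked on points. *)

Set Implicit Arguments.
Unset Strict Implicit.
Unset Printing Implicit Defensive.

Local Open Scope classical_set_scope.
Local Open Scope cat_scope.

Lemma dependent_choice (X : Type) (Y : X -> Type) (P : forall x, Y x -> Prop) :
  (forall x, exists y, P x y) -> exists f : forall x, Y x, forall x, P x (f x).
Proof.
by move=> ex; exists (fun x => projT1 (cid (ex x))) => x; case: cid.
Qed.

(** * Pullbacks and products *)

Section Squares.
Variable C : Category.

Lemma pullback_sym (A B D P : C) (f : hom A D) (g : hom B D)
    (p : hom P A) (q : hom P B) :
  is_pullback f g p q -> is_pullback g f q p.
Proof.
move=> [e univ]; split=> // T a b ab.
have [u [[pu qu] uniq_u]] := univ T b a (esym ab).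
by exists u; split=> // v [qv pv]; apply: uniq_u.
Qed.

Lemma pullback_ext (A B D P : C) (f : hom A D) (g : hom B D)
    (p : hom P A) (q : hom P B) (T : C) (u v : hom T P) :
  is_pullback f g p q -> p ∘ u = p ∘ v -> q ∘ u = q ∘ v -> u = v.
Proof.
move=> [e univ] pu qu.
have [|w [_ uniq_w]] := univ T (p ∘ v) (q ∘ v); first by rewrite !compA e.
by rewrite -(uniq_w u) // -(uniq_w v).
Qed.

Lemma product_ext (A B P : C) (p : hom P A) (q : hom P B) (T : C)
    (u v : hom T P) :
  is_product p q -> p ∘ u = p ∘ v -> q ∘ u = q ∘ v -> u = v.
Proof.
move=> univ pu qu; have [w [_ uniq_w]] := univ T (p ∘ v) (q ∘ v).
by rewrite -(uniq_w u) // -(uniq_w v).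
Qed.

Lemma terminal_ext (T X : C) (u v : hom X T) : is_terminal T -> u = v.
Proof. by move=> /(_ X) [w [_ uniq_w]]; rewrite -(uniq_w u) // -(uniq_w v). Qed.

Lemma pullback_paste (A A' B D P P' : C) (f : hom A D) (g : hom B D)
    (p : hom P A) (q : hom P B) (h : hom A' A) (p' : hom P' A')
    (q' : hom P' P) :
  is_pullback f g p q -> is_pullback h p p' q' ->
  is_pullback (f ∘ h) g p' (q ∘ q').
Proof.
move=> pb [e' univ']; have [e univ] := pb.
split; first by rewrite -compA e' compA e compA.
move=> T a b ab; have [|u [[pu qu] _]] := univ T (h ∘ a) b.
  by rewrite compA.
have [v [[pv qv] uniq_v]] := univ' T a u (esym pu).
exists v; split=> [|w [pw qw]]; first by rewrite -compA qv.
apply: uniq_v; split=> //; apply: (pullback_ext pb).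
  by rewrite compA -e' -compA pw.
by rewrite compA qw.
Qed.

Lemma pullback_cancel (A A' B D P P' : C) (f : hom A D) (g : hom B D)
    (p : hom P A) (q : hom P B) (h : hom A' A) (p' : hom P' A')
    (q' : hom P' P) :
  is_pullback f g p q -> is_pullback (f ∘ h) g p' (q ∘ q') ->
  h ∘ p' = p ∘ q' -> is_pullback h p p' q'.
Proof.
move=> pb pb' e'; split=> // T a u hau; have [e _] := pb.
have [_ univ'] := pb'; have [|v [[pv qv] _]] := univ' T a (q ∘ u).
  by rewrite -compA hau !compA e.
exists v; split.
  split=> //; apply: (pullback_ext pb); last by rewrite compA.
  by rewrite compA -e' -compA pv.
move=> w [pw qw]; apply: (pullback_ext pb'); first by rewrite pv pw.
by rewrite qv -qw !compA.
Qed.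

(** A pullback of the cospan [f, g], as data. *)
Record pullback_of (A B D : C) (f : hom A D) (g : hom B D) := PullbackOf {
  pb_ob : C;
  pb_fst : hom pb_ob A;
  pb_snd : hom pb_ob B;
  pbP : is_pullback f g pb_fst pb_snd
}.

(** A product of [A] and [B], as data. *)
Record product_of (A B : C) := ProductOf {
  prod_ob : C;
  prod_fst : hom prod_ob A;
  prod_snd : hom prod_ob B;
  prodP : is_product prod_fst prod_snd
}.

Lemma choose_pullback (A B D : C) (f : hom A D) (g : hom B D) :
  has_finite_limits C -> pullback_of f g.
Proof.
move=> [_ pbs]; have /cid [P /cid [p /cid [q pb]]] := pbs A B D f g.
exact: PullbackOf pb.
Qed.

Lemma choose_product (A B : C) : has_finite_limits C -> product_of A B.
Proof.
move=> lex; have [/cid [one oneP] _] := lex.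
have /cid [tA _] := oneP A; have /cid [tB _] := oneP B.
have [P p q [e univ]] := choose_pullback tA tB lex.
apply: (@ProductOf A B P p q) => T a b; apply: univ.
exact: terminal_ext oneP.
Qed.

Lemma pullback_family (N : Type) (D : N -> C) (X B : C) (x : hom X B)
    (c : forall n, hom (D n) B) : has_finite_limits C ->
  exists (Xn : N -> C) (p : forall n, hom (Xn n) X)
    (r : forall n, hom (Xn n) (D n)), forall n, is_pullback x (c n) (p n) (r n).
Proof.
move=> lex; pose pb n := choose_pullback x (c n) lex.
by exists (fun n => pb_ob (pb n)), (fun n => pb_fst (pb n)),
  (fun n => pb_snd (pb n)) => n; apply: pbP.
Qed.

End Squares.

(** * Colimits in an elementary topos *)

Section Colimits.
Variable C : Category.

(** [c] exhibits [B] as the colimit of the diagram with vertices [D n] whose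
    arrows are all the [e] such that [R n n' e] holds. *)
Definition is_colimit (N : Type) (D : N -> C)
    (R : forall n n', hom (D n) (D n') -> Prop) (B : C)
    (c : forall n, hom (D n) B) : Prop :=
  (forall n n' (e : hom (D n) (D n')), R n n' e -> c n' ∘ e = c n) /\
  forall (Z : C) (h : forall n, hom (D n) Z),
    (forall n n' (e : hom (D n) (D n')), R n n' e -> h n' ∘ e = h n) ->
    exists! k : hom B Z, forall n, k ∘ c n = h n.

Lemma colimit_ext (N : Type) (D : N -> C) R (B : C)
    (c : forall n, hom (D n) B) (Z : C) (u v : hom B Z) :
  is_colimit R c -> (forall n, u ∘ c n = v ∘ c n) -> u = v.
Proof.
move=> [cE univ] uv; have [|w [_ uniq_w]] := univ Z (fun n => v ∘ c n).
  by move=> n n' e Re; rewrite -compA cE.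
by rewrite -(uniq_w u) // -(uniq_w v).
Qed.

(** The arrows of the diagram obtained by pulling back a diagram [D] over [B]
    along a morphism into [B]: [p] and [r] are the projections. *)
Definition pulled_back_arrows (N : Type) (D : N -> C)
    (R : forall n n', hom (D n) (D n') -> Prop) (X : C) (Xn : N -> C)
    (p : forall n, hom (Xn n) X) (r : forall n, hom (Xn n) (D n))
    n n' (t : hom (Xn n) (Xn n')) : Prop :=
  p n' ∘ t = p n /\ exists2 e, R n n' e & r n' ∘ t = e ∘ r n.

End Colimits.

Section Topos.
Variable C : Category.
Hypothesis toposC : is_elementary_topos C.

Lemma topos_lex : has_finite_limits C.
Proof. by have [] := toposC. Qed.

(** In a cartesian closed category, the functor [- × M] preserves colimits,
    for it has a right adjoint. *)
Lemma colimit_times (N : Type) (D : N -> C) R (B : C)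
    (c : forall n, hom (D n) B) (M : C) (Q : N -> C)
    (r : forall n, hom (Q n) (D n)) (s : forall n, hom (Q n) M)
    (QB : C) (rB : hom QB B) (sB : hom QB M) (w : forall n, hom (Q n) QB) :
  is_colimit R c -> (forall n, is_product (r n) (s n)) -> is_product rB sB ->
  (forall n, rB ∘ w n = c n ∘ r n) -> (forall n, sB ∘ w n = s n) ->
  is_colimit (pulled_back_arrows R s r) w.
Proof.
move=> colim prQ prB rw sw; have [cE univ] := colim.
split=> [n n' v [sv [e Re rv]]|Z h hE].
  apply: (product_ext prB); last by rewrite compA !sw.
  by rewrite compA rw -compA rv compA cE // rw.
have [_ ccc _] := toposC.
have [E [P [p [q [ev [prP exp]]]]]] := ccc M Z.
have /dependent_choice [k kP] : forall n, exists k : hom (D n) E,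
    (exists u, [/\ p ∘ u = k ∘ r n, q ∘ u = s n & ev ∘ u = h n]) /\
    forall k',
      (exists u, [/\ p ∘ u = k' ∘ r n, q ∘ u = s n & ev ∘ u = h n]) -> k = k'.
  by move=> n; have [k [Pk Uk]] := exp _ _ _ _ (prQ n) (h n); exists k.
have kE n n' e : R n n' e -> k n' ∘ e = k n.
  move=> Re; symmetry; apply: (kP n).2.
  have [[u [pu qu eu]] _] := kP n'.
  have [v [[rv sv] _]] := prQ n' _ (e ∘ r n) (s n).
  exists (u ∘ v); split.
  - by rewrite compA pu -!compA rv.
  - by rewrite compA qu.
  - by rewrite compA eu; apply: hE; split=> //; exists e.
have [kB [kBE kBU]] := univ E k kE.
have [u [[pu qu] _]] := prP QB (kB ∘ rB) sB.
exists (ev ∘ u); split=> [n|g gE].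
  have [[un [pun qun <-]] _] := kP n; rewrite -compA; congr (_ ∘ _).
  apply: (product_ext prP); last by rewrite compA qu sw qun.
  by rewrite compA pu pun -compA rw compA kBE.
have [k' [[u' [pu' qu' eu']] _]] := exp _ _ _ _ prB g.
rewrite -eu'; congr (_ ∘ _); apply: (product_ext prP); last by rewrite qu qu'.
rewrite pu pu'; congr (_ ∘ _); apply: kBU => n; symmetry; apply: (kP n).2.
exists (u' ∘ w n); split.
- by rewrite compA pu' -!compA rw.
- by rewrite compA qu' sw.
- by rewrite compA eu' gE.
Qed.

Lemma classifier_ext (one Omega : C) (tr : hom one Omega) (U X : C)
    (m : hom U X) (chi chi' : hom X Omega) (t t' : hom U one) :
  is_subobject_classifier tr -> is_mono m ->
  is_pullback chi tr m t -> is_pullback chi' tr m t' -> chi = chi'.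
Proof.
move=> [_ cls] mono_m pb pb'; have [k [_ Uk]] := cls _ _ _ mono_m.
by transitivity k; [symmetry|]; apply: Uk; [exists t|exists t'].
Qed.

Section JointlyEpi.
Variables (N : Type) (D : N -> C) (R : forall n n', hom (D n) (D n') -> Prop).
Variables (B : C) (c : forall n, hom (D n) B).
Hypothesis colimB : is_colimit R c.
Variables (X : C) (x : hom X B) (Xn : N -> C) (p : forall n, hom (Xn n) X).
Variable r : forall n, hom (Xn n) (D n).
Hypothesis pbX : forall n, is_pullback x (c n) (p n) (r n).

(** The pullbacks of a colimiting cocone are jointly epimorphic: the graphs of
    [k1] and [k2], as subobjects of [B × (X × Z)], have classifying maps that
    agree on each [D n × (X × Z)], and these form a colimiting cocone. *)
Lemma pullback_jointly_epi (Z : C) (k1 k2 : hom X Z) :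
  (forall n, k1 ∘ p n = k2 ∘ p n) -> k1 = k2.
Proof.
move=> k12.
have [M a1 a2 prM] := choose_product X Z topos_lex.
have [QB rB sB prB] := choose_product B M topos_lex.
pose Q n := choose_product (D n) M topos_lex.
have /dependent_choice [w wP] : forall n, exists w : hom (prod_ob (Q n)) QB,
    rB ∘ w = c n ∘ prod_fst (Q n) /\ sB ∘ w = prod_snd (Q n).
  move=> n; have [w [wP _]] := prB _ (c n ∘ prod_fst (Q n))
    (prod_snd (Q n)).
  by exists w.
have colimQ := colimit_times colimB (fun n => prodP (Q n)) prB
  (fun n => (wP n).1) (fun n => (wP n).2).
have [one [Omega [tr trP]]] : has_subobject_classifier C by have [] := toposC.
(* The graph of [k : X -> Z], as a relation between [B] and [X × Z]. *)
have graph k : exists m : hom X QB,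
    [/\ rB ∘ m = x, a1 ∘ (sB ∘ m) = idm X & a2 ∘ (sB ∘ m) = k].
  have [b [[<- <-] _]] := prM _ (idm X) k.
  by have [m [[<- <-] _]] := prB _ x b; exists m.
have pb_graph k m :
    [/\ rB ∘ m = x, a1 ∘ (sB ∘ m) = idm X & a2 ∘ (sB ∘ m) = k] ->
    forall n (mn : hom (Xn n) (prod_ob (Q n))),
    prod_fst (Q n) ∘ mn = r n -> a1 ∘ (prod_snd (Q n) ∘ mn) = p n ->
    a2 ∘ (prod_snd (Q n) ∘ mn) = k ∘ p n ->
    is_pullback (w n) m mn (p n).
  move=> [rm a1m a2m] n mn rmn a1mn a2mn; have [rw sw] := wP n.
  have [pe punivX] := pbX n.
  have wm : w n ∘ mn = m ∘ p n.
    apply: (product_ext prB); first by rewrite !compA rw rm -compA rmn.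
    rewrite (compA sB) sw (compA sB).
    apply: (product_ext prM); first by rewrite a1mn compA a1m comp1m.
    by rewrite a2mn compA a2m.
  split=> // T a b wab.
  have [|u [[pu ru] Uu]] := punivX T b (prod_fst (Q n) ∘ a).
    by rewrite compA -rw -compA wab compA rm.
  exists u; split.
    split=> //; apply: (product_ext (prodP (Q n))); first by rewrite compA rmn.
    apply: (product_ext prM).
      rewrite (compA (prod_snd _)) compA a1mn pu -[b]comp1m -a1m.
      by rewrite -!compA -wab (compA sB) sw.
    rewrite (compA (prod_snd _)) compA a2mn -compA pu -a2m.
    by rewrite -!compA -wab (compA sB) sw.
  by move=> v [mv pv]; apply: Uu; split=> //; rewrite -rmn -compA mv.
have [m1 m1P] := graph k1; have [m2 m2P] := graph k2.
have mono_graph m : a1 ∘ (sB ∘ m) = idm X -> is_mono m.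
  by move=> e T u v uv; rewrite -[u]comp1m -[v]comp1m -e -!compA uv.
have [_ cls] := trP.
have [_ /mono_graph /cls [chi1 [[t1 pb1] _]] _] := m1P.
have [_ /mono_graph /cls [chi2 [[t2 pb2] _]] _] := m2P.
have chi12 : chi1 = chi2.
  apply: (colimit_ext colimQ) => n.
  have [b [[b1 b2] _]] := prM _ (p n) (k1 ∘ p n).
  have [mn [[rmn smn] _]] := prodP (Q n) (r n) b.
  have pbn1 := pb_graph k1 m1 m1P n mn.
  have pbn2 := pb_graph k2 m2 m2P n mn.
  rewrite smn -k12 in pbn1 pbn2.
  have {}pbn1 := pbn1 rmn b1 b2; have {}pbn2 := pbn2 rmn b1 b2.
  apply: (classifier_ext (m := mn) trP).
  - move=> T u v uv; apply: (pullback_ext (pbX n)); last first.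
      by rewrite -rmn -!compA uv.
    by rewrite -b1 -smn -!compA uv.
  - exact: pullback_paste pb1 pbn1.
  - exact: pullback_paste pb2 pbn2.
rewrite -chi12 in pb2; have [e1 _] := pb1; have [_ univ2] := pb2.
have [v [[m2v _] _]] := univ2 _ m1 t1 e1.
have [_ a1m1 <-] := m1P; have [_ a1m2 <-] := m2P.
suff v1 : v = idm X by rewrite -m2v v1 compm1.
by rewrite -[v]comp1m -[in LHS]a1m2 -!compA m2v a1m1.
Qed.

End JointlyEpi.

Section PullbackStability.
Variables (N : Type) (D : N -> C) (R : forall n n', hom (D n) (D n') -> Prop).
Variables (B : C) (c : forall n, hom (D n) B).
Hypothesis colimB : is_colimit R c.
Variables (X : C) (x : hom X B) (Xn : N -> C) (p : forall n, hom (Xn n) X).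
Variable r : forall n, hom (Xn n) (D n).
Hypothesis pbX : forall n, is_pullback x (c n) (p n) (r n).

(** Colimits are stable under pullback.  A compatible family [h] of morphisms
    [Xn n -> Z] amounts to subobjects of the [D n × (X × Z)]; their classifying
    maps glue to that of a relation between [B] and [X × Z], which is shown to
    be the graph of the required morphism [X -> Z]. *)
Lemma colimit_pullback : is_colimit (pulled_back_arrows R p r) p.
Proof.
split=> [n n' t [] //|Z h hE].
have [M a1 a2 prM] := choose_product X Z topos_lex.
have [QB rB sB prB] := choose_product B M topos_lex.
pose Q n := choose_product (D n) M topos_lex.
have /dependent_choice [w wP] : forall n, exists w : hom (prod_ob (Q n)) QB,
    rB ∘ w = c n ∘ prod_fst (Q n) /\ sB ∘ w = prod_snd (Q n).
  move=> n; have [w [wP _]] := prB _ (c n ∘ prod_fst (Q n))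
    (prod_snd (Q n)).
  by exists w.
have colimQ := colimit_times colimB (fun n => prodP (Q n)) prB
  (fun n => (wP n).1) (fun n => (wP n).2).
have [one [Omega [tr trP]]] : has_subobject_classifier C by have [] := toposC.
have [oneP cls] := trP.
(* The graph of the partial map [h n], as a relation between [D n] and
   [X × Z]. *)
have /dependent_choice [m mP] : forall n, exists m : hom (Xn n) (prod_ob (Q n)),
    [/\ prod_fst (Q n) ∘ m = r n, a1 ∘ (prod_snd (Q n) ∘ m) = p n &
        a2 ∘ (prod_snd (Q n) ∘ m) = h n].
  move=> n; have [b [[<- <-] _]] := prM _ (p n) (h n).
  by have [m [[<- <-] _]] := prodP (Q n) (r n) b; exists m.
have mono_m n : is_mono (m n).
  have [rm a1m _] := mP n.
  move=> T u v uv; apply: (pullback_ext (pbX n)); last by rewrite -rm -!compA uv.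
  by rewrite -a1m -!compA uv.
have /dependent_choice [g gP] : forall n, exists g : hom (prod_ob (Q n)) Omega,
    exists t, is_pullback g tr (m n) t.
  by move=> n; have [g [gP _]] := cls _ _ _ (mono_m n); exists g.
have gE n n' v : pulled_back_arrows R (fun n => prod_snd (Q n))
    (fun n => prod_fst (Q n)) v -> g n' ∘ v = g n.
  move=> [sv [e Re rv]]; have [t pbg] := gP n; have [t' pbg'] := gP n'.
  have [rm a1m a2m] := mP n; have [rm' a1m' a2m'] := mP n'.
  have [colimE _] := colimB; have [pbE' univ'] := pbX n'.
  have [pbE univ] := pbX n.
  have [|f [[pf rf] _]] := univ' _ (p n) (e ∘ r n).
    by rewrite compA colimE.
  have hf : h n' ∘ f = h n by apply: hE; split=> //; exists e.
  have mf : v ∘ m n = m n' ∘ f.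
    apply: (product_ext (prodP (Q n'))).
      by rewrite !compA rv rm' rf -compA rm.
    rewrite (compA _ v) sv (compA _ (m n')).
    apply: (product_ext prM); first by rewrite a1m compA a1m' pf.
    by rewrite a2m compA a2m' hf.
  apply: (classifier_ext (m := m n) (t := t' ∘ f) (t' := t) trP) => //.
  apply: pullback_paste pbg' _; split=> // T a b vab.
  have [|u [[pu ru] Uu]] := univ T (p n' ∘ b) (prod_fst (Q n) ∘ a).
    rewrite compA pbE' -rm' -!compA -vab (compA _ v) rv -compA compA.
    by rewrite colimE.
  have bfu : b = f ∘ u.
    apply: (pullback_ext (pbX n')); first by rewrite compA pf pu.
    by rewrite compA rf -compA ru compA -rv -compA vab compA rm'.
  exists u; split=> [|u' [mu' fu']].
    split=> //; apply: (product_ext (prodP (Q n))); first by rewrite compA rm.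
    by rewrite -sv -!compA vab bfu (compA v) mf -(compA _ f).
  apply: Uu; split; first by rewrite -pf -compA fu'.
  by rewrite -rm -compA mu'.
have [_ /(_ Omega g gE) [gB [gBE _]]] := colimQ.
(* [S] is the relation between [B] and [X × Z] with classifying map [gB]; its
   projection [sigma] to [X] turns out to be invertible. *)
have [S i tS pbS] := choose_pullback gB tr topos_lex.
have /dependent_choice [iX iXP] : forall n, exists iX : hom (Xn n) S,
    is_pullback i (w n) iX (m n).
  move=> n; have [t pbg] := gP n; rewrite -gBE in pbg.
  have [eg _] := pbg; have [eS univS] := pbS.
  have [|iX [[iiX tiX] _]] := univS _ (w n ∘ m n) t; first by rewrite compA.
  exists iX; apply: pullback_sym; apply: (pullback_cancel pbS) => //.
  by rewrite tiX.
have iw n : i ∘ iX n = w n ∘ m n by have [] := iXP n.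
have pb_iX n : is_pullback (rB ∘ i) (c n) (iX n) (r n).
  have [<- _ _] := mP n; apply: pullback_paste (iXP n).
  have [rw sw] := wP n; split=> // T a b ab.
  have [u [[ru su] _]] := prodP (Q n) b (sB ∘ a).
  exists u; split=> [|u' [wu' ru']].
    split=> //; apply: (product_ext prB); first by rewrite compA rw -compA ru.
    by rewrite compA sw.
  apply: (product_ext (prodP (Q n))); first by rewrite ru ru'.
  by rewrite su -sw -compA wu'.
have [sigma sigmaE] : exists sigma, sigma = a1 ∘ (sB ∘ i) by eexists.
have [zeta zetaE] : exists zeta, zeta = a2 ∘ (sB ∘ i) by eexists.
have sB_iX n : sB ∘ i ∘ iX n = prod_snd (Q n) ∘ m n.
  by have [_ sw] := wP n; rewrite -compA iw compA sw.
have sigma_iX n : sigma ∘ iX n = p n.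
  by have [_ <- _] := mP n; rewrite sigmaE -compA sB_iX.
have zeta_iX n : zeta ∘ iX n = h n.
  by have [_ _ <-] := mP n; rewrite zetaE -compA sB_iX.
have rB_sigma : rB ∘ i = x ∘ sigma.
  apply: (pullback_jointly_epi colimB pb_iX) => n.
  rewrite -[in RHS]compA sigma_iX.
  by have [-> _] := pbX n; have [-> _] := pb_iX n.
have mono_sigma : is_mono sigma.
  move=> T s s' ss'.
  pose Tn n := choose_pullback (x ∘ (sigma ∘ s)) (c n) topos_lex.
  apply: (pullback_jointly_epi colimB (fun n => pbP (Tn n))) => n.
  case: (Tn n) => T' tT rT /= [e _].
  have lift s0 : sigma ∘ s0 = sigma ∘ s ->
      exists2 v, s0 ∘ tT = iX n ∘ v &
        p n ∘ v = sigma ∘ s ∘ tT /\ r n ∘ v = rT.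
    move=> ss0; have [_ univ] := pb_iX n.
    have [|v [[iv rv] _]] := univ _ (s0 ∘ tT) rT.
      by rewrite rB_sigma -e !compA -(compA x sigma s0) ss0 (compA x).
    exists v => //; split=> //.
    by rewrite -sigma_iX -compA iv compA ss0.
  have [v -> [pv rv]] := lift s erefl.
  have [v' -> [pv' rv']] := lift s' (esym ss').
  by congr (_ ∘ _); apply: (pullback_ext (pbX n)); rewrite ?pv ?pv' ?rv ?rv'.
have [chi [[t pbchi] _]] := cls _ _ _ mono_sigma.
have [e _] := oneP X.
have chi_true : chi = tr ∘ e.
  apply: (pullback_jointly_epi colimB pbX) => n.
  have [chi_sigma _] := pbchi.
  rewrite -sigma_iX compA chi_sigma -!compA; congr (_ ∘ _).
  exact: terminal_ext oneP.
have [_ univchi] := pbchi.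
have [|v [[sigma_v _] _]] := univchi X (idm X) e; first by rewrite compm1.
have v_p n : v ∘ p n = iX n.
  by apply: mono_sigma; rewrite compA sigma_v comp1m sigma_iX.
exists (zeta ∘ v); split=> [n|k kE]; first by rewrite -compA v_p.
apply: (pullback_jointly_epi colimB pbX) => n.
by rewrite kE -compA v_p.
Qed.

End PullbackStability.

End Topos.

(** * Adjunctions and universal arrows *)

Section Adjunctions.
Variables (C D : Category) (L : Functor C D) (R : Functor D C).
Variable adj : Adjunction L R.

Lemma transpose_unit (X : C) (A : D) (x : hom X (R A)) :
  fmap R (transpose adj x) ∘ adj_unit adj X = x.
Proof.
rewrite /transpose fmap_comp -compA adj_unit_natural compA triangle_right.
exact: comp1m.
Qed.

Lemma transpose_uniq (X : C) (A : D) (g : hom (L X) A) :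
  transpose adj (fmap R g ∘ adj_unit adj X) = g.
Proof.
rewrite /transpose fmap_comp compA -adj_counit_natural -compA triangle_left.
exact: compm1.
Qed.

Lemma left_adjoint_colimit (N : Type) (Dn : N -> C) Rn (B : C)
    (c : forall n, hom (Dn n) B) :
  is_colimit Rn c ->
  is_colimit (D := fun n => L (Dn n))
    (fun n n' t => exists2 e, Rn n n' e & t = fmap L e) (fun n => fmap L (c n)).
Proof.
move=> [cE univ]; split=> [n n' t [e Re ->]|Z h hE].
  by rewrite -fmap_comp cE.
have [|k [kE kU]] := univ (R Z) (fun n => fmap R (h n) ∘ adj_unit adj (Dn n)).
  move=> n n' e Re; rewrite -compA -adj_unit_natural compA -fmap_comp.
  by rewrite hE //; exists e.
exists (transpose adj k); split=> [n|g gE].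
  rewrite -[RHS]transpose_uniq -kE /transpose fmap_comp.
  by rewrite compA.
rewrite (kU (fmap R g ∘ adj_unit adj B)) ?transpose_uniq // => n.
by rewrite -compA -adj_unit_natural compA -fmap_comp gE.
Qed.

End Adjunctions.

Section Universal.
Variables (F E : Category) (fs : Functor E F).

(** [u] is a universal arrow from [X] to the functor [fs]. *)
Definition is_universal (X : F) (L : E) (u : hom X (fs L)) : Prop :=
  forall (W : E) (h : hom X (fs W)), exists! g : hom L W, fmap fs g ∘ u = h.

Lemma universal_ext (X : F) (L : E) (u : hom X (fs L)) (W : E)
    (g g' : hom L W) :
  is_universal u -> fmap fs g ∘ u = fmap fs g' ∘ u -> g = g'.
Proof.
move=> univ gg'; have [k [_ kU]] := univ W (fmap fs g' ∘ u).
by rewrite -(kU g) // -(kU g').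
Qed.

(** A colimit of universal arrows, taken in both categories, is universal. *)
Lemma universal_colimit (N : Type) (P : N -> F) RP (PB : F)
    (p : forall n, hom (P n) PB) (Q : N -> E) RQ (QB : E)
    (q : forall n, hom (Q n) QB) (k : forall n, hom (P n) (fs (Q n)))
    (kB : hom PB (fs QB)) :
  is_colimit RP p -> is_colimit RQ q -> (forall n, is_universal (k n)) ->
  (forall n, fmap fs (q n) ∘ k n = kB ∘ p n) ->
  (forall n n' t, RQ n n' t ->
    exists2 s, RP n n' s & k n' ∘ s = fmap fs t ∘ k n) ->
  is_universal kB.
Proof.
move=> colimP colimQ univk kE lift W h.
have /dependent_choice [g gP] : forall n, exists g : hom (Q n) W,
    fmap fs g ∘ k n = h ∘ p n.
  by move=> n; have [g [gE _]] := univk n W (h ∘ p n); exists g.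
have [pE _] := colimP; have [_ univQ] := colimQ.
have [|gB [gBE _]] := univQ W g.
  move=> n n' t /lift [s RPs ks]; apply: (universal_ext (univk n)).
  by rewrite fmap_comp -compA -ks compA !gP -compA pE.
exists gB; split=> [|g' g'E].
  apply: (colimit_ext colimP) => n.
  by rewrite -compA -kE compA -fmap_comp gBE gP.
apply: (colimit_ext colimQ) => n; apply: (universal_ext (univk n)).
by rewrite gBE gP fmap_comp -compA kE compA g'E.
Qed.

(** If the vertices and the colimit of a diagram have universal arrows to [fs],
    the targets of these arrows form a colimiting cocone. *)
Lemma colimit_of_universal (N : Type) (X : N -> F) RX (XB : F)
    (c : forall n, hom (X n) XB) (L : N -> E) (LB : E)
    (u : forall n, hom (X n) (fs (L n))) (uB : hom XB (fs LB))
    (d : forall n, hom (L n) LB) :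
  is_colimit RX c -> (forall n, is_universal (u n)) -> is_universal uB ->
  (forall n, fmap fs (d n) ∘ u n = uB ∘ c n) ->
  is_colimit
    (fun n n' t => exists2 s, RX n n' s & u n' ∘ s = fmap fs t ∘ u n) d.
Proof.
move=> colimX univ univB dE; have [cE univX] := colimX.
split=> [n n' t [s RXs us]|Z h hE].
  apply: (universal_ext (univ n)).
  by rewrite fmap_comp -compA -us compA !dE -compA cE.
have [|k [kE _]] := univX (fs Z) (fun n => fmap fs (h n) ∘ u n).
  move=> n n' s RXs; have [t [tE _]] := univ n (L n') (u n' ∘ s).
  by rewrite -compA -tE compA -fmap_comp hE //; exists s.
have [g [gE _]] := univB Z k; exists g; split=> [n|g' g'E].
  apply: (universal_ext (univ n)).
  by rewrite fmap_comp -compA dE compA gE kE.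
apply: (universal_ext univB); apply: (colimit_ext colimX) => n.
by rewrite -!compA -dE !compA -!fmap_comp g'E fmap_comp -compA dE compA gE kE.
Qed.

(** Base change (the Beck-Chevalley condition) for [a : A -> B]: if
    [u : X -> fs L] is universal and [l : L -> B], then the comparison map
    [X ×_(fs B) fs A -> fs (L ×_B A)] is universal as well. *)
Definition base_change (A B : E) (a : hom A B) : Prop :=
  forall (X : F) (L : E) (u : hom X (fs L)), is_universal u ->
  forall (l : hom L B) (P : F) (p1 : hom P X) (p2 : hom P (fs A)),
  is_pullback (fmap fs l ∘ u) (fmap fs a) p1 p2 ->
  forall (Q : E) (q1 : hom Q L) (q2 : hom Q A), is_pullback l a q1 q2 ->
  forall k : hom P (fs Q),
  fmap fs q1 ∘ k = u ∘ p1 -> fmap fs q2 ∘ k = p2 -> is_universal k.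

Lemma base_change_idm (B : E) : base_change (idm B).
Proof.
move=> X L u univ l P p1 p2 [pE punivX] Q q1 q2 [qE qunivX] k k1 k2 W h.
have [|pi [[p1i _] _]] := punivX X (idm X) (fmap fs l ∘ u).
  by rewrite fmap_id comp1m compm1.
have [|qi [[q1i q2i] _]] := qunivX L (idm L) l.
  by rewrite comp1m compm1.
have ip1 : pi ∘ p1 = idm P.
  apply: (pullback_ext (conj pE punivX)).
    by rewrite compA p1i comp1m compm1.
  move: pE; rewrite fmap_id comp1m compm1 => pE.
  by rewrite -pE -compA (compA p1) p1i comp1m.
have iq1 : qi ∘ q1 = idm Q.
  apply: (pullback_ext (conj qE qunivX)).
    by rewrite compA q1i comp1m compm1.
  by move: qE; rewrite comp1m compm1 compA q2i.
have [g [gE gU]] := univ W (h ∘ pi); exists (g ∘ q1); split.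
  by rewrite fmap_comp -compA k1 compA gE -compA ip1 compm1.
move=> g' g'E; rewrite (gU (g' ∘ qi)); first by rewrite -compA iq1 compm1.
rewrite -[u]compm1 -p1i (compA u) -k1 fmap_comp -!compA (compA (fmap fs qi)).
by rewrite -fmap_comp iq1 fmap_id comp1m compA g'E.
Qed.

(** * Locality of base change *)

Hypotheses (toposF : is_elementary_topos F) (toposE : is_elementary_topos E).
Hypothesis lex_fs : preserves_finite_limits fs.
Variables (fdir : Functor F E) (adj : Adjunction fs fdir).
Hypothesis ex_universal :
  forall X : F, exists (L : E) (u : hom X (fs L)), is_universal u.

Let pb_fs (A B D P : E) (f : hom A D) (g : hom B D) (p : hom P A)
    (q : hom P B) : is_pullback f g p q ->
  is_pullback (fmap fs f) (fmap fs g) (fmap fs p) (fmap fs q).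
Proof. by have [_] := lex_fs; apply. Qed.

(** Base change is local on the source. *)
Lemma base_change_source (N : Type) (D : N -> E) R (A B : E)
    (c : forall n, hom (D n) A) (a : hom A B) :
  is_colimit R c -> (forall n, base_change (a ∘ c n)) -> base_change a.
Proof.
move=> colimA bc X L u univ l P p1 p2 pbP Q q1 q2 pbQ k k1 k2.
have [cE _] := colimA.
have [Pn [pp [pr pbPn]]] :=
  pullback_family p2 (fun n => fmap fs (c n)) (topos_lex toposF).
have [Qn [qq [qr pbQn]]] := pullback_family q2 c (topos_lex toposE).
have colimP := colimit_pullback toposF (left_adjoint_colimit adj colimA) pbPn.
have colimQ := colimit_pullback toposE colimA pbQn.
have pb_fsQ n := pb_fs (pbQn n).
have /dependent_choice [kn knP] : forall n, exists kn : hom (Pn n) (fs (Qn n)),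
    fmap fs (qq n) ∘ kn = k ∘ pp n /\ fmap fs (qr n) ∘ kn = pr n.
  move=> n; have [_ univQ] := pb_fsQ n.
  have [|kn [knP _]] := univQ _ (k ∘ pp n) (pr n); last by exists kn.
  by rewrite compA k2; have [-> _] := pbPn n.
apply: (universal_colimit (k := kn) colimP colimQ).
- move=> n; have [kqq kqr] := knP n.
  have pbL : is_pullback l (a ∘ c n) (q1 ∘ qq n) (qr n).
    apply: pullback_sym.
    exact: pullback_paste (pullback_sym pbQ) (pullback_sym (pbQn n)).
  have pbX :
      is_pullback (fmap fs l ∘ u) (fmap fs (a ∘ c n)) (p1 ∘ pp n) (pr n).
    rewrite fmap_comp; apply: pullback_sym.
    exact: pullback_paste (pullback_sym pbP) (pullback_sym (pbPn n)).
  apply: bc univ _ _ _ _ pbX _ _ _ pbL _ _ kqr.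
  by rewrite fmap_comp -compA kqq !compA k1.
- by move=> n; have [] := knP n.
move=> n n' t [qqt [e Re qrt]].
have [_ univP] := pbPn n'.
have [|s [[pps prs] _]] := univP _ (pp n) (fmap fs e ∘ pr n).
  by rewrite compA -fmap_comp cE //; have [] := pbPn n.
exists s; first by split=> //; exists (fmap fs e) => //; exists e.
have [kqq kqr] := knP n; have [kqq' kqr'] := knP n'.
apply: (pullback_ext (pb_fsQ n')).
  by rewrite !compA -fmap_comp kqq' qqt kqq -compA pps.
by rewrite !compA -fmap_comp kqr' qrt fmap_comp -compA kqr prs.
Qed.

(** Base change is local on the target. *)
Lemma base_change_target (N : Type) (D : N -> E) R (A B : E)
    (c : forall n, hom (D n) B) (a : hom A B) :
  is_colimit R c ->
  (forall n (An : E) (an : hom An (D n)) (bn : hom An A),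
    is_pullback (c n) a an bn -> base_change an) ->
  base_change a.
Proof.
move=> colimB bc X L u univ l P p1 p2 pbP Q q1 q2 pbQ k k1 k2.
have lexE := topos_lex toposE; have lexF := topos_lex toposF.
(* [X] is the colimit of the [Xn n], hence [L] that of the [Ln n]; then [P] and
   [Q] are the colimits of the [Pn n] and the [Qn n]. *)
have [Xn [p [r pbXn]]] :=
  pullback_family (fmap fs l ∘ u) (fun n => fmap fs (c n)) lexF.
have colimX := colimit_pullback toposF (left_adjoint_colimit adj colimB) pbXn.
have /dependent_choice [Ln /dependent_choice [un univn]] :
    forall n, exists (L : E) (v : hom (Xn n) (fs L)), is_universal v.
  by move=> n; apply: ex_universal.
have /dependent_choice [ln lnP] : forall n, exists ln : hom (Ln n) (D n),
    fmap fs ln ∘ un n = r n.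
  by move=> n; have [ln [lnP _]] := univn n (D n) (r n); exists ln.
have /dependent_choice [d dP] : forall n, exists d : hom (Ln n) L,
    fmap fs d ∘ un n = u ∘ p n.
  by move=> n; have [d [dP _]] := univn n L (u ∘ p n); exists d.
have colimL := colimit_of_universal colimX univn univ dP.
have [Pn [pp [pr pbPn]]] := pullback_family p1 p lexF.
have [Qn [qq [qr pbQn]]] := pullback_family q1 d lexE.
have [An [an [bn pbAn]]] := pullback_family a c lexE.
have colimP := colimit_pullback toposF colimX pbPn.
have colimQ := colimit_pullback toposE colimL pbQn.
have pb_fsQ n := pb_fs (pbQn n).
have ld n : l ∘ d n = c n ∘ ln n.
  apply: (universal_ext (univn n)); rewrite !fmap_comp -!compA dP lnP compA.
  by have [] := pbXn n.
have /dependent_choice [kn knP] : forall n, exists kn : hom (Pn n) (fs (Qn n)),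
    fmap fs (qq n) ∘ kn = k ∘ pp n /\ fmap fs (qr n) ∘ kn = un n ∘ pr n.
  move=> n; have [_ univQ] := pb_fsQ n.
  have [|kn [knP _]] := univQ _ (k ∘ pp n) (un n ∘ pr n); last by exists kn.
  by rewrite !compA k1 dP -!compA; have [-> _] := pbPn n.
apply: (universal_colimit (k := kn) colimP colimQ).
- move=> n; have [kqq kqr] := knP n.
  have pbQ' : is_pullback (c n ∘ ln n) a (qr n) (q2 ∘ qq n).
    by rewrite -ld; apply: pullback_paste pbQ (pullback_sym (pbQn n)).
  have [|v [[av bv] _]] := (pbAn n).2 _ (q2 ∘ qq n) (ln n ∘ qr n).
    by rewrite (compA (c n)); have [-> _] := pbQ'.
  have pbL : is_pullback (ln n) (bn n) (qr n) v.
    by apply: (pullback_cancel (pullback_sym (pbAn n))); rewrite ?av.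
  have pbP' : is_pullback (fmap fs (c n) ∘ (fmap fs (ln n) ∘ un n))
      (fmap fs a) (pr n) (p2 ∘ pp n).
    rewrite lnP; have [<- _] := pbXn n.
    exact: pullback_paste pbP (pullback_sym (pbPn n)).
  have pb_fsA := pb_fs (pullback_sym (pbAn n)).
  have fskv : fmap fs (an n) ∘ (fmap fs v ∘ kn n) = p2 ∘ pp n.
    by rewrite compA -fmap_comp av fmap_comp -compA kqq compA k2.
  have fskl :
      fmap fs (bn n) ∘ (fmap fs v ∘ kn n) = fmap fs (ln n) ∘ un n ∘ pr n.
    by rewrite compA -fmap_comp bv fmap_comp -compA kqr compA.
  have pbX : is_pullback (fmap fs (ln n) ∘ un n) (fmap fs (bn n)) (pr n)
      (fmap fs v ∘ kn n).
    by apply: (pullback_cancel pb_fsA); rewrite ?fskv.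
  exact: bc (pullback_sym (pbAn n)) _ _ _ (univn n) _ _ _ _ pbX _ _ _ pbL _ kqr _.
- by move=> n; have [] := knP n.
move=> n n' t [qqt [e [s [ps RXs] us] qrt]].
have [_ univP] := pbPn n'.
have [|s' [[pps prs] _]] := univP _ (pp n) (s ∘ pr n).
  by rewrite compA ps; have [] := pbPn n.
exists s'; first by split=> //; exists s.
have [kqq kqr] := knP n; have [kqq' kqr'] := knP n'.
apply: (pullback_ext (pb_fsQ n')).
  by rewrite !compA -fmap_comp kqq' qqt kqq -compA pps.
by rewrite !compA -fmap_comp kqr' qrt fmap_comp -!compA kqr prs compA us compA.
Qed.

End Universal.

(** Base change for [a] gives a universal arrow from [P] to the pullback [Q];
    comparing it with the unit at [P] shows that the natural morphism is
    invertible. *)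
Lemma locally_connected_of_base_change (F E : Category)
    (f : GeometricMorphism F E) :
  essential f ->
  (forall (A B : E) (a : hom A B), base_change (inverse_image f) a) ->
  locally_connected f.
Proof.
move=> ess bc; split=> // fb adj A B X a x P p1 p2 Q q1 q2 pbP pbQ k q1k q2k.
have univ (Y : F) : is_universal (adj_unit adj Y).
  move=> W h; exists (transpose adj h); split; first exact: transpose_unit.
  by move=> g <-; apply: transpose_uniq.
have univk : is_universal (fmap (inverse_image f) k ∘ adj_unit adj P).
  apply: (bc _ _ a _ _ _ (univ X) (transpose adj x) P p1 p2 _ Q q1 q2 pbQ).
  - by rewrite transpose_unit.
  - by rewrite compA -fmap_comp q1k adj_unit_natural.
  - by rewrite compA -fmap_comp q2k transpose_unit.
have [g [gE _]] := univk _ (adj_unit adj P).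
exists g; split.
  by apply: (universal_ext (univ P)); rewrite fmap_comp -compA gE fmap_id comp1m.
apply: (universal_ext univk).
by rewrite fmap_comp -compA gE fmap_id comp1m.
Qed.

(** * Continuous actions on discrete sets *)

Section TopologicalGroups.
Variable G : topologicalGroupType.
Local Open Scope group_scope.

Lemma mulg_cvg (T : Type) (F : set_system T) {FF : Filter F} (u v : T -> G)
    (a b : G) :
  u @ F --> a -> v @ F --> b -> (fun t => u t * v t) @ F --> a * b.
Proof.
move=> ua vb.
exact: (@cvg_comp _ _ _ (fun t => (u t, v t)) (fun z : G * G => z.1 * z.2) F
  _ _ (cvg_pair ua vb) (@mulg_continuous G (a, b))).
Qed.

Lemma near_mulVg (h : G) (A : set G) :
  nbhs 1 A -> \forall g \near h, A (h^-1 * g).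
Proof.
have : (fun g => h^-1 * g) @ h --> h^-1 * h.
  by apply: mulg_cvg; [exact: cvg_cst|exact: cvg_id].
by rewrite mulVg => hcvg A1; apply: hcvg.
Qed.

Lemma near_conjg (h : G) (A : set G) :
  nbhs 1 A -> \forall g \near 1, A (h^-1 * g * h).
Proof.
have : (fun g => h^-1 * g * h) @ (1 : G) --> h^-1 * 1 * h.
  apply: mulg_cvg; last exact: cvg_cst.
  by apply: mulg_cvg; [exact: cvg_cst|exact: cvg_id].
by rewrite mulg1 mulVg => hcvg A1; apply: hcvg.
Qed.

Lemma actVK (X : ContSet G) (g : G) (x : X) : act g (act g^-1 x) = x.
Proof. by rewrite -actM mulgV act1. Qed.

Lemma actKV (X : ContSet G) (g : G) (x : X) : act g^-1 (act g x) = x.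
Proof. by rewrite -actM mulVg act1. Qed.

Lemma act_near (X : ContSet G) (h : G) (x : X) :
  \forall g' \near h & y \near (x : discrete X), act g' y = act h x.
Proof.
apply: (@act_continuous G X (h, x) [set y | y = act h x]).
by rewrite /= nbhs_principalE; apply/principal_filterP.
Qed.

Lemma stabilizer_open (X : ContSet G) (x : X) :
  \forall g \near (1 : G), act g x = x.
Proof.
have [[A B] [A1 Bx] AB] := act_near 1 x.
apply: filterS A1 => g Ag; rewrite -[RHS]act1; apply: (AB (g, x)); split=> //.
exact: (@nbhs_singleton (discrete X)).
Qed.

Lemma act_continuous_of_stabilizers (X : Type) (f : G -> X -> X) :
  (forall x, f 1 x = x) -> (forall g h x, f (g * h) x = f g (f h x)) ->
  (forall x, \forall g \near (1 : G), f g x = x) ->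
  continuous (fun z : G * discrete X => f z.1 z.2 : discrete X).
Proof.
move=> f1 fM stab [h x] A /=; rewrite nbhs_principalE => /principal_filterP /= Ax.
exists ([set g | f g x = f h x], [set x : discrete X]) => /=.
  split; last by rewrite nbhs_principalE; apply/principal_filterP.
  have := near_mulVg h (stab x); apply: filterS => g /= gx.
  by rewrite -[in RHS]gx -fM mulgA mulgV mul1g.
by case=> g y [/= gx ->]; rewrite gx.
Qed.

(** A continuous action, from the openness of its stabilizers. *)
Definition cont_set (X : Type) (f : G -> X -> X)
    (f1 : forall x, f 1 x = x) (fM : forall g h x, f (g * h) x = f g (f h x))
    (stab : forall x, \forall g \near (1 : G), f g x = x) : ContSet G :=
  Build_ContSet f1 fM (act_continuous_of_stabilizers f1 fM stab).

End TopologicalGroups.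

Lemma sval_ext (T : Type) (P : T -> Prop) (s t : {x | P x}) :
  sval s = sval t -> s = t.
Proof. by case: s t => [x Px] [y Py]; apply: eq_exist. Qed.

Section Constructions.
Variable G : topologicalGroupType.
Local Open Scope group_scope.

Lemma near_refl (T : Type) (x : T) : \forall g \near (1 : G), x = x.
Proof. exact: nearW. Qed.

(** A set with the trivial action. *)
Definition trivial_cont (X : Type) : ContSet G :=
  cont_set (f := fun _ (x : X) => x) (fun=> erefl) (fun _ _ _ => erefl)
    (@near_refl X).

Lemma sub_cont_subproof (X : ContSet G) (S : X -> Prop)
    (Sact : forall g x, S x -> S (act g x)) :
  let f g (x : {x | S x}) := exist S (act g (sval x)) (Sact g _ (svalP x)) in
  (forall x, f 1 x = x) /\ (forall g h x, f (g * h) x = f g (f h x)) /\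
    (forall x, \forall g \near (1 : G), f g x = x).
Proof.
move=> f; split=> [[x Sx]|]; last split=> [g h [x Sx]|[x Sx]].
- by apply: eq_exist; rewrite /= act1.
- by apply: eq_exist; rewrite /= actM.
- by apply: filterS (stabilizer_open x) => g gx; apply: eq_exist.
Qed.

(** An invariant subset. *)
Definition sub_cont (X : ContSet G) (S : X -> Prop)
    (Sact : forall g x, S x -> S (act g x)) : ContSet G :=
  let fP := sub_cont_subproof Sact in cont_set fP.1 fP.2.1 fP.2.2.

Lemma prod_cont_subproof (X Y : ContSet G) :
  let f g (z : X * Y) := (act g z.1, act g z.2) in
  (forall x, f 1 x = x) /\ (forall g h x, f (g * h) x = f g (f h x)) /\
    (forall x, \forall g \near (1 : G), f g x = x).
Proof.
move=> f; split=> [[x y]|]; last split=> [g h [x y]|[x y]];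
  rewrite /f /= ?act1 ?actM //.
by apply: filterS2 (stabilizer_open x) (stabilizer_open y) => g -> ->.
Qed.

(** The product, with the diagonal action. *)
Definition prod_cont (X Y : ContSet G) : ContSet G :=
  let fP := prod_cont_subproof X Y in cont_set fP.1 fP.2.1 fP.2.2.

(** [f] commutes with the action of the single element [g]. *)
Definition equivariant_function (X Y : ContSet G) (g : G) (f : X -> Y) : Prop :=
  forall x, act g (f x) = f (act g x).

(** [f] commutes with all elements of some neighbourhood of the unit. *)
Definition smooth (X Y : ContSet G) (f : X -> Y) : Prop :=
  \forall h \near (1 : G), equivariant_function h f.

Lemma smooth_act (X Y : ContSet G) (g : G) (f : X -> Y) :
  smooth f -> smooth (fun x => act g (f (act g^-1 x))).
Proof.
rewrite /smooth => /(near_conjg g); apply: filterS => h hf x; rewrite -!actM.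
rewrite -[X in act X _ = _](_ : g * (g^-1 * h * g) = h * g).
  by rewrite actM hf -actM -!mulgA mulgV mulg1.
by rewrite !mulgA mulgV mul1g.
Qed.

Lemma exp_cont_subproof (X Y : ContSet G) :
  let f g (u : {f : X -> Y | smooth f}) :=
    exist (@smooth X Y) _ (smooth_act g (svalP u)) in
  (forall x, f 1 x = x) /\ (forall g h x, f (g * h) x = f g (f h x)) /\
    (forall x, \forall g \near (1 : G), f g x = x).
Proof.
move=> f; split=> [[u Su]|]; last split=> [g h [u Su]|[u Su]].
- by apply: eq_exist; apply/funext => x; rewrite /= invg1 !act1.
- by apply: eq_exist; apply/funext => x; rewrite /= invgM !actM.
apply: (filterS _ (Su)) => g gu; apply: eq_exist; apply/funext => x /=.
by rewrite gu actVK.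
Qed.

(** The exponential: the smooth functions, acted upon by conjugation. *)
Definition exp_cont (X Y : ContSet G) : ContSet G :=
  let fP := exp_cont_subproof X Y in cont_set fP.1 fP.2.1 fP.2.2.

End Constructions.

(** * The disjoint union is an elementary topos *)

Section DisjointUnion.
Variables (I : Type) (G : I -> topologicalGroupType).

Notation E := (disjoint_union (fun i : I => Cont (G i))).

(** The component of index [i] of an object. *)
Definition fib (A : E) (i : I) : ContSet (G i) := A i.

(** The value of a morphism at a point of its source. *)
Definition ap (A B : E) (f : hom A B) (i : I) (x : fib A i) : fib B i :=
  map_fun (f i) x.

(** A morphism, from the underlying equivariant functions. *)
Definition mk_hom (A B : E) (f : forall i, fib A i -> fib B i)
    (fE : forall i g x, f i (act g x) = act g (f i x)) : hom A B :=
  fun i => Build_EquivariantMap (fE i).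

Lemma ap_act (A B : E) (f : hom A B) i g (x : fib A i) :
  ap f (act g x) = act g (ap f x).
Proof. exact: map_equivariant. Qed.

Lemma ap_comp (A B D : E) (f : hom B D) (g : hom A B) i (x : fib A i) :
  ap (f ∘ g) x = ap f (ap g x).
Proof. by []. Qed.

Lemma hom_ext (A B : E) (f g : hom A B) :
  (forall i (x : fib A i), ap f x = ap g x) -> f = g.
Proof.
move=> fg; apply: functional_extensionality_dep => i.
by apply: equivariant_map_ext => x; apply: fg.
Qed.

(** An invariant relation that is functional defines a morphism. *)
Lemma exists_hom (A B : E) (R : forall i, fib A i -> fib B i -> Prop) :
  (forall i x, exists y, R i x y /\ forall y', R i x y' -> y = y') ->
  (forall i g x y, R i x y -> R i (act g x) (act g y)) ->
  exists f : hom A B, forall i x, R i x (ap f x).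
Proof.
move=> ex Ract; pose f i x : fib B i := projT1 (cid (ex i x)).
have fP i x : R i x (f i x) by rewrite /f; case: cid => ? [].
have fU i x y : R i x y -> f i x = y.
  by rewrite /f; case: cid => z [? zU] /=; apply: zU.
have fE i g x : f i (act g x) = act g (f i x) by apply: fU; apply: Ract.
by exists (mk_hom fE).
Qed.

(** The terminal object. *)
Definition oneE : E := fun i => trivial_cont (G i) unit.

Lemma oneE_terminal : is_terminal oneE.
Proof.
move=> A.
exists (@mk_hom A oneE (fun _ _ => tt) (fun _ _ _ => erefl)).
split=> // f _; apply: hom_ext => i x.
by case: (ap f x).
Qed.

(** Pullback squares are recognized on points. *)
Lemma pullback_of_points (A B D P : E) (f : hom A D) (g : hom B D)
    (p : hom P A) (q : hom P B) :
  (forall i (z : fib P i), ap f (ap p z) = ap g (ap q z)) ->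
  (forall i (a : fib A i) (b : fib B i), ap f a = ap g b ->
    exists2 z : fib P i, ap p z = a /\ ap q z = b &
      forall z', ap p z' = a -> ap q z' = b -> z = z') ->
  is_pullback f g p q.
Proof.
move=> e univ; split=> [|T a b ab]; first exact: hom_ext.
have [|i g' t z [pz qz]|u uP] := @exists_hom T P
    (fun i t z => ap p z = ap a t /\ ap q z = ap b t).
- move=> i t; have [|z [pz qz] Uz] := univ i (ap a t) (ap b t).
    by rewrite -!ap_comp ab.
  by exists z; split=> // z' [pz' qz']; apply: Uz.
- by rewrite !ap_act pz qz.
exists u; split=> [|v [pv qv]].
  by split; apply: hom_ext => i t; have [] := uP i t.
apply: hom_ext => i t; have [pu qu] := uP i t.
have [|z _ Uz] := univ i (ap a t) (ap b t); first by rewrite -!ap_comp ab.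
by rewrite -(Uz (ap u t)) // -(Uz (ap v t)) // -?pv -?qv.
Qed.

Lemma pullbackE_act (A B D : E) (f : hom A D) (g : hom B D) i h
    (z : prod_cont (fib A i) (fib B i)) :
  ap f z.1 = ap g z.2 -> ap f (act h z).1 = ap g (act h z).2.
Proof. by move=> e; rewrite /= !ap_act e. Qed.

(** The pullback of [f] and [g]: the pairs of points with the same image. *)
Definition pullbackE (A B D : E) (f : hom A D) (g : hom B D) : E :=
  fun i => sub_cont (@pullbackE_act A B D f g i).

Definition pullbackE_fst (A B D : E) (f : hom A D) (g : hom B D) :
    hom (pullbackE f g) A :=
  @mk_hom (pullbackE f g) A (fun i z => (sval z).1) (fun _ _ _ => erefl).

Definition pullbackE_snd (A B D : E) (f : hom A D) (g : hom B D) :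
    hom (pullbackE f g) B :=
  @mk_hom (pullbackE f g) B (fun i z => (sval z).2) (fun _ _ _ => erefl).

Lemma pullbackE_is_pullback (A B D : E) (f : hom A D) (g : hom B D) :
  is_pullback f g (pullbackE_fst f g) (pullbackE_snd f g).
Proof.
apply: pullback_of_points => [i [] //|i a b ab].
exists (exist _ (a, b) ab : fib (pullbackE f g) i) => //.
by case=> [[a' b'] e'] /= aa' bb'; apply: eq_exist; rewrite -aa' -bb'.
Qed.

Lemma pullback_points (A B D P : E) (f : hom A D) (g : hom B D)
    (p : hom P A) (q : hom P B) i (a : fib A i) (b : fib B i) :
  is_pullback f g p q -> ap f a = ap g b ->
  exists2 z : fib P i, ap p z = a /\ ap q z = b &
    forall z', ap p z' = a -> ap q z' = b -> z = z'.
Proof.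
move=> [e univ] ab; have [e' univ'] := pullbackE_is_pullback f g.
have [u [[pu qu] _]] := univ _ _ _ e'.
have [v [[pv qv] _]] := univ' _ _ _ e.
exists (ap u (exist _ (a, b) ab : fib (pullbackE f g) i)).
  by rewrite -!ap_comp pu qu.
move=> z pz qz.
have <- : ap (u ∘ v) z = z.
  suff -> : u ∘ v = idm P by [].
  by apply: (pullback_ext (conj e univ)); rewrite compm1 compA ?pu ?qu.
rewrite ap_comp; congr (ap u _); apply: (@sval_ext _ _ (exist _ (a, b) ab)).
by rewrite /= -pz -qz -pv -qv /= !ap_comp /=; case: (ap v z) => [[]].
Qed.

Lemma lexE : has_finite_limits E.
Proof.
split; first by exists oneE; apply: oneE_terminal.
move=> A B D f g.
exists (pullbackE f g), (pullbackE_fst f g), (pullbackE_snd f g).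
exact: pullbackE_is_pullback.
Qed.

Lemma product_points (A B P : E) (p : hom P A) (q : hom P B) i
    (a : fib A i) (b : fib B i) :
  is_product p q ->
  exists2 z : fib P i, ap p z = a /\ ap q z = b &
    forall z', ap p z' = a -> ap q z' = b -> z = z'.
Proof.
have [tA _] := oneE_terminal A; have [tB _] := oneE_terminal B.
move=> univ; apply: (@pullback_points _ _ _ _ tA tB).
  by split=> [|T a' b' _]; [apply: terminal_ext oneE_terminal | apply: univ].
by case: (ap tA a); case: (ap tB b).
Qed.

(** Monomorphisms are injective: test them on the kernel pair. *)
Lemma mono_inj (A B : E) (m : hom A B) i (x y : fib A i) :
  is_mono m -> ap m x = ap m y -> x = y.
Proof.
move=> mono_m xy; have [e _] := pullbackE_is_pullback m m.
have /(congr1 (fun f => ap f (exist _ (x, y) xy : fib (pullbackE m m) i))) :=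
  mono_m _ _ _ e.
by [].
Qed.

(** The componentwise product. *)
Definition prodE (A B : E) : E := fun i => prod_cont (fib A i) (fib B i).

Definition prodE_fst (A B : E) : hom (prodE A B) A :=
  @mk_hom (prodE A B) A (fun i z => z.1) (fun _ _ _ => erefl).

Definition prodE_snd (A B : E) : hom (prodE A B) B :=
  @mk_hom (prodE A B) B (fun i z => z.2) (fun _ _ _ => erefl).

Lemma prodE_is_product (A B : E) : is_product (prodE_fst A B) (prodE_snd A B).
Proof.
move=> T a b.
pose f i x : fib (prodE A B) i := (ap a x, ap b x).
have fE i g x : f i (act g x) = act g (f i x) by rewrite /f !ap_act.
exists (@mk_hom T (prodE A B) _ fE); split; first by split; apply: hom_ext.
move=> v [va vb]; apply: hom_ext => i t.
by rewrite -[LHS]/(f i t) /f -va -vb !ap_comp /=; case: (ap v t).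
Qed.

(** The exponential [B^A]. *)
Definition expE (A B : E) : E := fun i => exp_cont (fib A i) (fib B i).

Lemma expE_eval_act (A B : E) i g (z : fib (prodE (expE A B) A) i) :
  sval (act g z).1 (act g z).2 = act g (sval z.1 z.2).
Proof. by rewrite /= actKV. Qed.

(** The evaluation morphism. *)
Definition expE_eval (A B : E) : hom (prodE (expE A B) A) B :=
  mk_hom (@expE_eval_act A B).

Lemma expE_is_exponential (A B : E) :
  is_exponential (prodE_fst (expE A B) A) (prodE_snd (expE A B) A)
    (expE_eval A B).
Proof.
split=> [|T Q r s prQ h]; first exact: prodE_is_product.
pose pt i (t : fib T i) (a : fib A i) : fib Q i :=
  s2val (cid2 (product_points t a prQ)).
have ptP i t a : ap r (pt i t a) = t /\ ap s (pt i t a) = a.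
  exact: (s2valP (cid2 (product_points t a prQ))).
have ptU i t a q : ap r q = t -> ap s q = a -> pt i t a = q.
  exact: (s2valP' (cid2 (product_points t a prQ))).
have pt_act i g t a : pt i (act g t) (act g a) = act g (pt i t a).
  by have [rt sa] := ptP i t a; apply: ptU; rewrite ap_act ?rt ?sa.
have k_smooth i (t : fib T i) : smooth (fun a : fib A i => ap h (pt i t a)).
  apply: filterS (stabilizer_open t) => g gt a.
  by rewrite -ap_act -pt_act gt.
pose k i t : fib (expE A B) i :=
  exist (@smooth _ (fib A i) (fib B i)) _ (k_smooth i t).
have kE i g t : k i (act g t) = act g (k i t).
  apply: sval_ext; apply/funext => a /=.
  by rewrite -ap_act -pt_act actVK.
exists (mk_hom kE); split.
  have [u [[pu qu] _]] := prodE_is_product (mk_hom kE ∘ r) s.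
  exists u; split=> //; apply: hom_ext => i q.
  have e1 : (ap u q).1 = k i (ap r q).
    by rewrite -[LHS]/(ap (prodE_fst _ _ ∘ u) q) pu.
  have e2 : (ap u q).2 = ap s q.
    by rewrite -[LHS]/(ap (prodE_snd _ _ ∘ u) q) qu.
  rewrite ap_comp -[LHS]/(sval (ap u q).1 (ap u q).2) e1 e2 /=.
  by congr (ap h _); apply: ptU.
move=> k' [u [pu qu eu]]; apply: hom_ext => i t; apply: sval_ext.
apply/funext => a /=.
have [rpt spt] := ptP i t a.
rewrite -[in LHS]eu ap_comp -[LHS]/(sval (ap u (pt i t a)).1 (ap u (pt i t a)).2).
rewrite -[(ap u _).1]/(ap (prodE_fst _ _ ∘ u) _) pu.
rewrite -[(ap u _).2]/(ap (prodE_snd _ _ ∘ u) _) qu.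
by rewrite ap_comp rpt spt.
Qed.

(** The subobject classifier: invariant subsets have invariant complements, so
    the set of all propositions with the trivial action will do. *)
Definition omegaE : E := fun i => trivial_cont (G i) Prop.

(** The generic subobject. *)
Definition trueE : hom oneE omegaE :=
  @mk_hom oneE omegaE (fun _ _ => True) (fun _ _ _ => erefl).

Lemma trueE_is_classifier : is_subobject_classifier trueE.
Proof.
split=> [|U X m mono_m]; first exact: oneE_terminal.
pose chi i (x : fib X i) : fib omegaE i := exists u, ap m u = x.
have chiE i g x : chi i (act g x) = act g (chi i x).
  apply: propext; split=> [[u mu]|[u mu]].
    by exists (act g^-1%g u); rewrite ap_act mu actKV.
  by exists (act g u); rewrite ap_act mu.
exists (mk_hom chiE); split.
  have [t _] := oneE_terminal U; exists t; apply: pullback_of_points.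
    by move=> i u; apply: propext; split=> // _; exists u.
  move=> i x b e; have [u mu] : chi i x.
    by rewrite -[chi i x]/(ap (mk_hom chiE) x) e.
  exists u; first by split=> //; case: b e (ap t u) => _ [].
  by move=> u' mu' _; apply: (mono_inj mono_m); rewrite mu.
move=> chi' [t pb]; apply: hom_ext => i x; apply: propext; split.
  by case=> u <-; have [e _] := pb; rewrite -ap_comp e.
move=> chi'x.
have [|u [mu _] _] := pullback_points (a := x) (b := tt : fib oneE i) pb.
  by apply: propext.
by exists u.
Qed.

Lemma disjoint_union_topos : is_elementary_topos E.
Proof.
split; first exact: lexE.
  move=> A B; exists (expE A B), (prodE (expE A B) A), (prodE_fst _ _),
    (prodE_snd _ _), (expE_eval A B).
  exact: expE_is_exponential.
by exists oneE, omegaE, trueE; apply: trueE_is_classifier.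
Qed.

End DisjointUnion.

(** * Uniform objects and split morphisms *)

Section Density.
Variables (I : Type) (G : I -> topologicalGroupType).

Notation E := (disjoint_union (fun i : I => Cont (G i))).

(** The type of all morphisms to [B] in the class [S]. *)
Definition over (B : E) (S : forall Y : E, hom Y B -> Prop) : Type :=
  {Y : E & {y : hom Y B | S Y y}}.

(** The morphism itself. *)
Definition over_map (B : E) (S : forall Y : E, hom Y B -> Prop) (n : over S) :
  hom (projT1 n) B := sval (projT2 n).

(** A jointly surjective class of morphisms to [B] that is closed under fibre
    products exhibits [B] as a colimit. *)
Lemma density (B : E) (S : forall Y : E, hom Y B -> Prop) :
  (forall i (b : fib B i), exists (Y : E) (y : hom Y B),
    S Y y /\ exists v : fib Y i, ap y v = b) ->
  (forall Y y Y' y', S Y y -> S Y' y' -> S _ (y ∘ pullbackE_fst y y')) ->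
  is_colimit
    (fun (n n' : over S) (e : hom (projT1 n) (projT1 n')) =>
      over_map n' ∘ e = over_map n)
    (@over_map B S).
Proof.
move=> cover closed; split=> // Z h hE.
(* The colimit map sends [b] to the common value of the [h n] at the points
   lying over [b]. *)
pose R i (b : fib B i) (w : fib Z i) :=
  exists (n : over S) (v : fib (projT1 n) i),
    ap (over_map n) v = b /\ ap (h n) v = w.
have RU i b w w' : R i b w -> R i b w' -> w = w'.
  move=> [n [v [<- <-]]] [n' [v' [vv' <-]]].
  pose y := over_map n; pose y' := over_map n'.
  pose m : over S := existT _ (pullbackE y y') (exist _ _
    (closed _ _ _ _ (svalP (projT2 n)) (svalP (projT2 n')))).
  pose z : fib (projT1 m) i := exist _ (v, v') (esym vv').
  have e : ap (h n) v = ap (h m) z.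
    by rewrite -(hE m n (pullbackE_fst y y') erefl).
  have e' : ap (h n') v' = ap (h m) z.
    have [yy _] := pullbackE_is_pullback y y'.
    by rewrite -(hE m n' (pullbackE_snd y y') (esym yy)).
  by rewrite e e'.
have [i b|i g b w [n [v [vb vw]]]|k kP] := @exists_hom I G B Z R.
- have [Y [y [Sy [v vb]]]] := cover i b.
  pose n : over S := existT _ Y (exist _ y Sy).
  have Rb : R i b (ap (h n) v) by exists n, v.
  by exists (ap (h n) v); split=> // w; apply: RU.
- by exists n, (act g v); rewrite !ap_act vb vw.
exists k; split=> [n|k' k'E]; apply: hom_ext => i v.
  by apply: RU (kP i _) _; exists n, v.
by have [n [v' [<- <-]]] := kP i v; rewrite -k'E.
Qed.

(** [A] is uniform if in each component some neighbourhood of the unit acts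
    trivially. *)
Definition uniform (A : E) : Prop :=
  forall i, \forall g \near (1%g : G i), forall x : fib A i, act g x = x.

Lemma uniform_pullbackE (A B D : E) (f : hom A D) (g : hom B D) :
  uniform A -> uniform B -> uniform (pullbackE f g).
Proof.
move=> uA uB i; apply: filterS2 (uA i) (uB i) => h hA hB x.
by apply: sval_ext; rewrite /= hA hB; case: x => [[]].
Qed.

(** [x] lies in the orbit of [a]; its index [i] must then be that of [a]. *)
Definition in_orbit (A : E) i0 (a : fib A i0) i (x : fib A i) : Prop :=
  exists (e : i0 = i) (g : G i), x = act g (eq_rect i0 (fib A) a i e).

Lemma in_orbit_act (A : E) i0 (a : fib A i0) i (g : G i) (x : fib A i) :
  in_orbit a x -> in_orbit a (act g x).
Proof. by move=> [e [h ->]]; exists e, (g * h)%g; rewrite actM. Qed.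

(** The orbit of a point; its other components are empty. *)
Definition orbitE (A : E) i0 (a : fib A i0) : E :=
  fun i => sub_cont (@in_orbit_act A i0 a i).

Definition orbitE_incl (A : E) i0 (a : fib A i0) : hom (orbitE a) A :=
  @mk_hom I G (orbitE a) A (fun i x => sval x) (fun _ _ _ => erefl).

(** By compactness, the stabilizers of all the [act h a] share a neighbourhood
    of the unit. *)
Lemma uniform_orbitE (A : E) i0 (a : fib A i0) :
  compact [set: G i0] -> uniform (orbitE a).
Proof.
move=> cpt i; have [[_ [e _]]|noe] := pselect (exists x : fib A i, in_orbit a x);
  last first.
  by apply: nearW => g [x xa]; case: noe; exists x.
case: i / e => /=.
have : \forall g \near (1%g : G i0), [set: G i0] `<=`
    (fun h => act g (act h a) = act h a).
  move/compact_near_coveringP: cpt; apply => h _.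
  have stab := stabilizer_open (act h a).
  have [[/= U V] [Uh Va] UV] := act_near h a.
  exists (U, [set g | act g (act h a) = act h a]) => // -[h' g] [/= Uh' ga].
  have -> // : act h' a = act h a.
  apply: (UV (h', a)); split=> //.
  exact: (@nbhs_singleton (discrete (fib A i0))).
apply: filterS => g ga [x [e [h xE]]]; apply: sval_ext => /=.
by rewrite xE (Prop_irrelevance e erefl) /=; apply: ga.
Qed.

Lemma uniform_density (A : E) : (forall i, compact [set: G i]) ->
  is_colimit
    (fun (n n' : over (fun Y (_ : hom Y A) => uniform Y))
      (e : hom (projT1 n) (projT1 n')) => over_map n' ∘ e = over_map n)
    (@over_map A _).
Proof.
move=> cpt; apply: density => [i a|Y y Y' y']; last exact: uniform_pullbackE.
exists (orbitE a), (orbitE_incl a); split; first exact: uniform_orbitE.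
have aa : in_orbit a a by exists erefl, 1%g; rewrite act1.
by exists (exist _ a aa : fib (orbitE a) i).
Qed.

(** [a] splits along [y]: its pullback along [y : Y -> B] is a disjoint union
    of copies of [Y], given by the morphisms [s j : Y -> A] over [B]. *)
Definition split_along (A B Y : E) (a : hom A B) (y : hom Y B) : Prop :=
  exists (J : Type) (s : J -> hom Y A),
    (forall j, a ∘ s j = y) /\
    forall i (v : fib Y i) (x : fib A i), ap a x = ap y v ->
      exists2 j, ap (s j) v = x & forall j', ap (s j') v = x -> j = j'.

Lemma split_along_comp (A B Y Y' : E) (a : hom A B) (y : hom Y B)
    (t : hom Y' Y) : split_along a y -> split_along a (y ∘ t).
Proof.
move=> [J [s [sE sU]]]; exists J, (fun j => s j ∘ t); split=> [j|i v x xv].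
  by rewrite compA sE.
by have [j sj jU] := sU i (ap t v) x xv; exists j.
Qed.

Section Trivializations.
Variables (A B : E) (a : hom A B) (uA : uniform A) (J : Type).

Lemma fam_cont_subproof i :
  let f (g : G i) (s : J -> fib A i) := fun j => act g (s j) in
  (forall x, f 1%g x = x) /\ (forall g h x, f (g * h)%g x = f g (f h x)) /\
    (forall x, \forall g \near (1%g : G i), f g x = x).
Proof.
move=> f; split=> [s|]; last split=> [g h s|s].
- by apply/funext => j; apply: act1.
- by apply/funext => j; apply: actM.
by apply: filterS (uA i) => g gA; apply/funext => j; apply: gA.
Qed.

(** The families of points of [A] indexed by [J], with the pointwise action; it
    is continuous, for arbitrary [J], because [A] is uniform. *)
Definition fam_cont i : ContSet (G i) :=
  let fP := fam_cont_subproof i in cont_set fP.1 fP.2.1 fP.2.2.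

(** [z.1] is a bijection from [J] onto the fibre of [a] over [z.2]. *)
Definition trivialization i (z : prod_cont (fam_cont i) (fib B i)) : Prop :=
  (forall j, ap a (z.1 j) = z.2) /\
  forall x, ap a x = z.2 ->
    exists2 j, z.1 j = x & forall j', z.1 j' = x -> j = j'.

Lemma trivialization_act i g z :
  @trivialization i z -> trivialization (act g z).
Proof.
move=> [zE zU]; split=> [j|x] /=; first by rewrite ap_act zE.
move=> xz; have [|j zj jU] := zU (act g^-1%g x); first by rewrite ap_act xz actKV.
exists j => [|j' zj']; first by rewrite zj actVK.
by apply: jU; rewrite -zj' actKV.
Qed.

(** The object of bijections between [J] and a fibre of [a]. *)
Definition trivE : E := fun i => sub_cont (@trivialization_act i).

Definition trivE_base : hom trivE B :=
  @mk_hom I G trivE B (fun i z => (sval z).2) (fun _ _ _ => erefl).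

Definition trivE_section (j : J) : hom trivE A :=
  @mk_hom I G trivE A (fun i z => (sval z).1 j) (fun _ _ _ => erefl).

Lemma split_along_trivE_base : split_along a trivE_base.
Proof.
exists J, trivE_section; split=> [j|i z x xz].
  by apply: hom_ext => i z; apply: (svalP z).1.
exact: (svalP z).2 xz.
Qed.

End Trivializations.

Lemma split_density (A B : E) (a : hom A B) : uniform A ->
  is_colimit
    (fun (n n' : over (fun Y (y : hom Y B) => split_along a y))
      (e : hom (projT1 n) (projT1 n')) => over_map n' ∘ e = over_map n)
    (@over_map B _).
Proof.
move=> uA; apply: density => [i b|Y y Y' y' yS _]; last exact: split_along_comp.
(* The fibre over [b], trivialized by its own inclusion into [A]. *)
pose J := {x : fib A i | ap a x = b}.
exists (trivE a uA J), (trivE_base a uA J).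
split; first exact: split_along_trivE_base.
have zP : @trivialization A B a uA J i (fun j : J => sval j, b).
  split=> [j|x xb]; first by case: j.
  exists (exist _ x xb : J) => // j jx.
  by apply: (@sval_ext _ _ (exist _ x xb) j).
by exists (exist _ _ zP : fib (trivE a uA J) i).
Qed.

(** The sections of the pullback of [a] given by a splitting exhibit it as a
    coproduct of copies of [Y]. *)
Lemma split_along_coproduct (A B Y P : E) (a : hom A B) (y : hom Y B)
    (p : hom P Y) (q : hom P A) :
  split_along a y -> is_pullback y a p q ->
  exists (J : Type) (c : J -> hom Y P), (forall j, p ∘ c j = idm Y) /\
    is_colimit (D := fun _ : J => Y) (fun _ _ _ => False) c.
Proof.
move=> [J [s [sE sU]]] pb; exists J; have [pq univ] := pb.
have /dependent_choice [c cP] : forall j, exists c : hom Y P,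
    p ∘ c = idm Y /\ q ∘ c = s j.
  move=> j; have [|c [cP _]] := univ Y (idm Y) (s j); last by exists c.
  by rewrite compm1 sE.
exists c; split=> [j|]; first by have [] := cP j.
split=> // Z h _.
have sUP i (z : fib P i) :=
  sU i (ap p z) (ap q z) (congr1 (fun f => ap f z) (esym pq)).
have [i z|i g z w [j [sj hj]]|k kP] := @exists_hom I G P Z
    (fun i z w => exists j, ap (s j) (ap p z) = ap q z /\ ap (h j) (ap p z) = w).
- have [j sj jU] := sUP i z.
  exists (ap (h j) (ap p z)); split; first by exists j.
  by move=> w [j' [/jU <- <-]].
- by exists j; rewrite !ap_act sj hj.
have pc j i v : ap p (ap (c j) v) = v :> fib Y i.
  by rewrite -ap_comp; have [-> _] := cP j.
have qc j i v : ap q (ap (c j) v) = ap (s j) v :> fib A i.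
  by rewrite -ap_comp; have [_ ->] := cP j.
exists k; split=> [j|k' k'E]; apply: hom_ext => i.
  move=> v; rewrite ap_comp; have [j' [sj' <-]] := kP i (ap (c j) v).
  have [j0 _ j0U] := sUP i (ap (c j) v).
  by rewrite -(j0U _ sj') (j0U j) ?pc ?qc.
move=> z; have [j [sj <-]] := kP i z.
have [z0 _ zU] := pullback_points (a := ap p z) (b := ap q z) pb
  (congr1 (fun f => ap f z) pq).
have zc : z = ap (c j) (ap p z).
  by transitivity z0; [symmetry|]; apply: zU; rewrite ?pc ?qc.
by rewrite -k'E ap_comp -zc.
Qed.

(** Every morphism satisfies base change along every essential geometric
    morphism. *)
Lemma base_changeE (F : Category) (f : GeometricMorphism F E) (A B : E)
    (a : hom A B) :
  (forall i, compact [set: G i]) -> is_elementary_topos F -> essential f ->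
  base_change (inverse_image f) a.
Proof.
move=> cpt toposF [fb [fb_adj]].
have toposE := disjoint_union_topos G.
have lex := inverse_image_lex f; have adj := geom_adj f.
have ex_univ (X : F) :
    exists (L : E) (u : hom X (inverse_image f L)), is_universal u.
  exists (fb X), (adj_unit fb_adj X) => W h.
  exists (transpose fb_adj h); split; first exact: transpose_unit.
  by move=> g <-; apply: transpose_uniq.
(* Reduction to the case where [A] is uniform, then to the case where [a] is
   split. *)
apply: (base_change_source toposF toposE lex adj (uniform_density A cpt)) => n.
apply: (base_change_target toposF toposE lex adj ex_univ
  (split_density _ (svalP (projT2 n)))) => m P p q pb.
have [J [c [pc colimP]]] := split_along_coproduct (svalP (projT2 m)) pb.
apply: (base_change_source toposF toposE lex adj colimP) => j.
by rewrite pc; apply: base_change_idm.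
Qed.

End Density.

Theorem proposition4p3 (I : Type) (G : I -> topologicalGroupType)
    (compactG : forall i : I, compact [set: G i]) :
  EILC (disjoint_union (fun i : I => Cont (G i))).
Proof.
split; first exact: disjoint_union_topos.
move=> F toposF f ess; apply: locally_connected_of_base_change => // A B a.
exact: base_changeE.
Qed.
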